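(* Consider signed groups that admit an anticommutative generator of length $n$ (such a group has order $2^{n+1}$ when $n$ is finite). Up to isomorphism of signed groups: (1) if $n\ge2$ is even, there are exactly two non-isomorphic such groups; (2) if $n\ge2$ is odd, there are exactly three non-isomorphic such groups; (3) if $n=\infty$ (a countably infinite anticommutative generator), there is only one such signed group.
   Context: A signed group is a group containing a central element $-1\neq1$ with $(-1)^2=1$ such that any two elements either commute or anticommute ($ef=-fe$) and each element $e$ has signature $e^2\in\{\pm1\}$. For a sequence $\mathbf e$ and finitary $0$-$1$ sequence $\mathbf p$, $\mathbf e^{\mathbf p}=e_1^{p_1}e_2^{p_2}\cdots$. A sequence is basic if no $\mathbf e^{\mathbf p}$ with $\mathbf p\ne\mathbf 0$ equals $\pm1$; a generator is a basic sequence, and it generates the group $\{\pm\mathbf e^{\mathbf p}\}$. An anticommutative generator is one whose distinct terms pairwise anticommute; the signatures of its terms are arbitrary. Isomorphisms of signed groups are group isomorphisms sending $-1$ to $-1$. *)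

(* Defs.v *)
From mathcomp Require Import all_boot.
Set Implicit Arguments. Unset Strict Implicit. Unset Printing Implicit Defensive.

Record signed_group := SignedGroup {
  sg_car :> Type;
  sg_mul : sg_car -> sg_car -> sg_car;
  sg_one : sg_car;
  sg_inv : sg_car -> sg_car;
  sg_m   : sg_car;
  sg_mulA : forall x y z, sg_mul x (sg_mul y z) = sg_mul (sg_mul x y) z;
  sg_mul1x : forall x, sg_mul sg_one x = x;
  sg_mulx1 : forall x, sg_mul x sg_one = x;
  sg_mulVx : forall x, sg_mul (sg_inv x) x = sg_one;
  sg_mulxV : forall x, sg_mul x (sg_inv x) = sg_one;
  sg_m_neq1 : sg_m <> sg_one;
  sg_m_sqr : sg_mul sg_m sg_m = sg_one;
  sg_m_central : forall x, sg_mul sg_m x = sg_mul x sg_m;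
  sg_comm_or_anti : forall e f,
      sg_mul e f = sg_mul f e \/ sg_mul e f = sg_mul sg_m (sg_mul f e);
  sg_signature : forall e, sg_mul e e = sg_one \/ sg_mul e e = sg_m
}.

Section SignedGroupDefs.
Variable G : signed_group.
Local Notation mul := (@sg_mul G).
Local Notation one := (@sg_one G).
Local Notation m := (@sg_m G).

Fixpoint eprod_from (e : nat -> G) (i : nat) (p : seq bool) : G :=
  match p with
  | [::] => one
  | b :: p' => mul (if b then e i else one) (eprod_from e i.+1 p')
  end.

(* e^p = e_0^{p_0} e_1^{p_1} ... ; a finitary 0-1 sequence is represented
   by a finite list p (all later entries being 0). *)
Definition eprod (e : nat -> G) (p : seq bool) : G := eprod_from e 0 p.

(* Finite sequences of length n: the terms e 0, ..., e (n-1). *)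
Definition basic_fin (n : nat) (e : nat -> G) : Prop :=
  forall p : seq bool, size p <= n -> has id p ->
    eprod e p <> one /\ eprod e p <> m.

Definition generates_fin (n : nat) (e : nat -> G) : Prop :=
  forall g : G, exists p : seq bool, size p <= n /\
    (g = eprod e p \/ g = mul m (eprod e p)).

Definition anticommutative_fin (n : nat) (e : nat -> G) : Prop :=
  forall i j, i < n -> j < n -> i <> j -> mul (e i) (e j) = mul m (mul (e j) (e i)).

Definition ac_generator_fin (n : nat) (e : nat -> G) : Prop :=
  [/\ basic_fin n e, generates_fin n e & anticommutative_fin n e].

Definition basic_inf (e : nat -> G) : Prop :=
  forall p : seq bool, has id p -> eprod e p <> one /\ eprod e p <> m.

Definition generates_inf (e : nat -> G) : Prop :=
  forall g : G, exists p : seq bool, g = eprod e p \/ g = mul m (eprod e p).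

Definition anticommutative_inf (e : nat -> G) : Prop :=
  forall i j, i <> j -> mul (e i) (e j) = mul m (mul (e j) (e i)).

Definition ac_generator_inf (e : nat -> G) : Prop :=
  [/\ basic_inf e, generates_inf e & anticommutative_inf e].

End SignedGroupDefs.

Definition has_ac_generator_fin (n : nat) (G : signed_group) : Prop :=
  exists e : nat -> G, ac_generator_fin n e.

Definition has_ac_generator_inf (G : signed_group) : Prop :=
  exists e : nat -> G, ac_generator_inf e.

Definition sg_iso (G H : signed_group) : Prop :=
  exists f : G -> H,
    [/\ bijective f,
        (forall x y, f (@sg_mul G x y) = @sg_mul H (f x) (f y)) &
        f (@sg_m G) = @sg_m H].

(* Main.v *)
Require Import Defs.
From mathcomp Require Import all_boot fingroup perm zify.
From Stdlib Require Import ClassicalEpsilon FunctionalExtensionality ProofIrrelevance.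
Set Implicit Arguments. Unset Strict Implicit. Unset Printing Implicit Defensive.

(* The square of e^p is a quadratic form on the exponents p, so a signed group
   with an anticommutative generator is determined by its length and the number
   k of terms of signature -1.  Two changes of generator relate different k:
   - multiplying all other terms by a term of signature +1 flips their
     signatures, so k becomes n - 1 - k;
   - if w is the product of four terms of equal signature, multiplying these
     four terms by w flips their signatures, so k becomes k - 4.
   For finite n this leaves two or three classes, according to the parity of n.
   They are separated by the number of exponents p with (e^p)^2 = 1, computed by
   a linear recurrence for suitable representatives.  For infinite length the
   second move, applied to infinitely many quadruples at once, makes all
   signatures +1. *)

(** * Signed monoids *)

(** The operators that later realize the signatures form only a monoid of this kind; on the span of
    an anticommuting sequence the remaining laws of a signed group hold. *)
Record signed_monoid := SignedMonoid {
  sm_car :> Type;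
  sm_mul : sm_car -> sm_car -> sm_car;
  sm_one : sm_car;
  sm_m : sm_car;
  sm_mulA : forall x y z, sm_mul x (sm_mul y z) = sm_mul (sm_mul x y) z;
  sm_mul1x : forall x, sm_mul sm_one x = x;
  sm_mulx1 : forall x, sm_mul x sm_one = x;
  sm_m_neq1 : sm_m <> sm_one;
  sm_m_sqr : sm_mul sm_m sm_m = sm_one;
  sm_m_central : forall x, sm_mul sm_m x = sm_mul x sm_m }.

Declare Scope sm_scope.
Delimit Scope sm_scope with sm.
Notation "x * y" := (sm_mul x y) : sm_scope.

(* A length [o] is [Some n] or [None], the latter standing for infinity. *)
Definition within (o : option nat) (k : nat) : bool :=
  if o is Some n then k <= n else true.

Lemma within_leq o k l : k <= l -> within o l -> within o k.
Proof. by case: o => //= n; exact: leq_trans. Qed.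

Lemma within0 o : within o 0. Proof. by case: o. Qed.

Lemma within_max o k l : within o k -> within o l -> within o (maxn k l).
Proof. by case: o => //= n; rewrite geq_max => -> ->. Qed.

(** * Exponent sequences and the sign cocycle *)

(** Missing entries count as 0, so [~~ has id (xors p q)] says that [p] and [q] agree up to trailing
    zeros. *)
Fixpoint xors (p q : seq bool) : seq bool :=
  match p, q with
  | [::], _ => q
  | _, [::] => p
  | a :: p', b :: q' => (a (+) b) :: xors p' q'
  end.

Lemma size_xors p q : size (xors p q) = maxn (size p) (size q).
Proof.
by elim: p q => [|a p IH] [|b q] //=; rewrite IH maxnSS.
Qed.

Lemma xorsC p q : xors p q = xors q p.
Proof. by elim: p q => [|a p IH] [|b q] //=; rewrite IH addbC. Qed.

Lemma has_xors_self p : has id (xors p p) = false.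
Proof. by elim: p => //= a p ->; rewrite addbb. Qed.

Lemma xors_eq p q : size p = size q -> ~~ has id (xors p q) -> p = q.
Proof.
elim: p q => [|a p IH] [|b q] //= [/IH{}IH]; rewrite negb_or => /andP[ab /IH->].
by case: a b ab => [] [].
Qed.

(* The signature of [e i] is recorded by the bit [s i]; the cocycle is the sign
   of [e^p e^q] relative to [e^(p xor q)] in an anticommutative sequence. *)
Fixpoint cocycle (s : nat -> bool) (i : nat) (p q : seq bool) : bool :=
  match p, q with
  | a :: p', b :: q' =>
      [&& s i, a & b] (+) (b && odd (count id p')) (+) cocycle s i.+1 p' q'
  | _, _ => false
  end.

Fixpoint bseqs n : seq (seq bool) :=
  if n is n'.+1 then map (cons true) (bseqs n') ++ map (cons false) (bseqs n')
  else [:: [::]].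

Lemma mem_bseqs n p : (p \in bseqs n) = (size p == n).
Proof.
have cons_inj a : injective (cons a : seq bool -> _) by move=> u v [].
have notin (a b : bool) (q : seq bool) r : a != b -> (a :: q \in map (cons b) r) = false.
  by move=> ab; apply/mapP => -[u _ [E]]; rewrite E eqxx in ab.
elim: n p => [|n IH] [|a p] //=; rewrite mem_cat.
  by apply/negP => /orP[] /mapP[].
by case: a; rewrite (mem_map (@cons_inj _)) notin // ?orbF IH.
Qed.

Lemma uniq_bseqs n : uniq (bseqs n).
Proof.
elim: n => //= n IH; rewrite cat_uniq !map_inj_uniq ?IH => [|u v []|u v []] //.
by rewrite andbT; apply/hasPn => _ /mapP[p _ ->]; apply/mapP => -[].
Qed.

(** * Signs, commutation and products in a signed monoid *)

Section SignedMonoid.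
Variable M : signed_monoid.
Implicit Types (x y z : M) (e f : nat -> M) (p q : seq bool) (s : nat -> bool).
Implicit Types (o : option nat).
Local Open Scope sm_scope.
Local Notation one := (sm_one M).
Local Notation m := (sm_m M).

Definition sgn (b : bool) : M := if b then m else one.

Lemma sgnD a b : sgn a * sgn b = sgn (a (+) b).
Proof. by case: a b => [] [] /=; rewrite ?sm_mul1x ?sm_mulx1 ?sm_m_sqr. Qed.

Lemma sgnDA a b x : sgn a * (sgn b * x) = sgn (a (+) b) * x.
Proof. by rewrite sm_mulA sgnD. Qed.

Lemma sgnC b x : sgn b * x = x * sgn b.
Proof. by case: b => /=; rewrite ?sm_m_central ?sm_mul1x ?sm_mulx1. Qed.

Lemma sgnCA b x y : x * (sgn b * y) = sgn b * (x * y).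
Proof. by rewrite sm_mulA -sgnC sm_mulA. Qed.

Lemma sgn0 x : sgn false * x = x. Proof. exact: sm_mul1x. Qed.

Lemma sgn_inj : injective sgn.
Proof. by case=> [] [] //= /esym; [move/esym|]; move/sm_m_neq1. Qed.

(** Recording the commutation sign as a bit makes it additive in each argument. *)
Definition skew (b : bool) x y := x * y = sgn b * (y * x).

Lemma skew_sym b x y : skew b x y -> skew b y x.
Proof. by rewrite /skew => ->; rewrite sgnDA addbb sgn0. Qed.

Lemma skewM a b x y z : skew a x z -> skew b y z -> skew (a (+) b) (x * y) z.
Proof.
rewrite /skew => xz yz.
by rewrite -sm_mulA yz sgnCA [x * _]sm_mulA xz -!sm_mulA sgnDA addbC.
Qed.

Lemma skewMr a b x y z : skew a z x -> skew b z y -> skew (a (+) b) z (x * y).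
Proof. by move=> /skew_sym zx /skew_sym zy; apply/skew_sym/skewM. Qed.

Lemma skew_refl x : skew false x x. Proof. by rewrite /skew sgn0. Qed.

Lemma skew1 x : skew false x one.
Proof. by rewrite /skew sgn0 sm_mulx1 sm_mul1x. Qed.

Lemma sq_mul b x y : skew b x y -> x * y * (x * y) = sgn b * (x * x * (y * y)).
Proof.
move=> /skew_sym yx; rewrite -sm_mulA [y * _]sm_mulA yx -sm_mulA !sgnCA.
by rewrite !sm_mulA.
Qed.

Fixpoint gprod_from e (i : nat) p : M :=
  match p with
  | [::] => one
  | b :: p' => (if b then e i else one) * gprod_from e i.+1 p'
  end.
Definition gprod e p := gprod_from e 0 p.

Lemma eq_gprod_from e f o i p : (forall j, within o j.+1 -> e j = f j) ->
  within o (i + size p) -> gprod_from e i p = gprod_from f i p.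
Proof.
move=> ef; elim: p i => //= b p IH i; rewrite -addSnnS => le_p; rewrite IH //.
by case: b => //; rewrite ef // (within_leq _ le_p) ?leq_addr.
Qed.

Lemma gprod_from_zero e i p : ~~ has id p -> gprod_from e i p = one.
Proof.
by elim: p i => //= -[] p IH i //= /IH->; rewrite sm_mul1x.
Qed.

Lemma gprod_from_xors e i p q :
  ~~ has id (xors p q) -> gprod_from e i p = gprod_from e i q.
Proof.
elim: p q i => [|a p IH] [|b q] i //=.
- by move/(@gprod_from_zero e i (b :: q)).
- by move/(@gprod_from_zero e i (a :: p)).
by rewrite negb_or => /andP[ab /IH->]; case: a b ab => [] [].
Qed.

Lemma gprod_from_pad e i p k :
  gprod_from e i (p ++ nseq k false) = gprod_from e i p.
Proof.
elim: p i => [|b p IH] i /=; last by rewrite IH.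
by rewrite gprod_from_zero // has_nseq andbF.
Qed.

Lemma gprod_from_single e i k :
  gprod_from e i (rcons (nseq k false) true) = e (i + k)%N.
Proof.
elim: k i => [|k IH] i /=; first by rewrite sm_mulx1 addn0.
by rewrite IH sm_mul1x addSnnS.
Qed.

Definition anticommutative o e := forall i j,
  within o i.+1 -> within o j.+1 -> i <> j -> skew true (e i) (e j).

Definition signature o e s := forall i, within o i.+1 -> e i * e i = sgn (s i).

Definition basic o e := forall p, within o (size p) -> has id p ->
  gprod e p <> one /\ gprod e p <> m.

Definition span o e x := exists b p,
  within o (size p) /\ x = sgn b * gprod e p.

Definition generator o e :=
  [/\ basic o e, forall x, span o e x & anticommutative o e].

(** * The multiplication rule for an anticommuting sequence *)

Section Products.
Variables (o : option nat) (e : nat -> M) (s : nat -> bool).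
Hypotheses (anti_e : anticommutative o e) (sig_e : signature o e s).

(** [e j] anticommutes with every factor of the product except itself, if it occurs there. *)
Lemma skew_gprod_from i j p : within o j.+1 -> within o (i + size p) ->
  skew (odd (count id p) (+) ((i <= j) && nth false p (j - i)))
    (e j) (gprod_from e i p).
Proof.
move=> j_o; elim: p i => [|a p IH] i /= le_p.
  by rewrite nth_nil andbF; exact: skew1.
rewrite -addSnnS in le_p; have i_o := within_leq (leq_addr (size p) i.+1) le_p.
have sk1 : skew (a && (i != j)) (e j) (if a then e i else one).
  case: a => /=; last exact: skew1.
  case: eqP => [->|ij]; first exact: skew_refl.
  by apply: anti_e => // /esym.
suff <- : a && (i != j) (+) (odd (count id p) (+)
    ((i.+1 <= j) && nth false p (j - i.+1))) =
    odd (a + count id p) (+) ((i <= j) && nth false (a :: p) (j - i)).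
  exact: skewMr sk1 (IH _ le_p).
rewrite oddD oddb; case: (ltngtP i j) => [ij|ij|<-] /=.
- by rewrite andbT -(subnSK ij) /= addbA.
- by rewrite andbT !addbF.
- by rewrite subnn /= andbF addbF /= addbC addbA addbb.
Qed.

(** In the inductive step the leading term of the second product moves left past the tail of the
    first; this is the summand [b && odd (count id p')] of the cocycle. *)
Lemma gprod_from_mul i p q : within o (i + size p) -> within o (i + size q) ->
  gprod_from e i p * gprod_from e i q =
  sgn (cocycle s i p q) * gprod_from e i (xors p q).
Proof.
elim: p q i => [|a p IH] [|b q] i /= le_p le_q; rewrite ?sgn0 ?sm_mul1x ?sm_mulx1 //.
rewrite -!addSnnS in le_p le_q.
have i_o := within_leq (leq_addr (size p) i.+1) le_p.
set x := if a then e i else one; set y := if b then e i else one.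
have py : skew (b && odd (count id p)) (gprod_from e i.+1 p) y.
  rewrite /y; case: (b) => /=; last exact: skew1.
  apply: skew_sym; have := skew_gprod_from i_o le_p.
  by rewrite ltnn addbF.
have xy : x * y = sgn [&& s i, a & b] * (if a (+) b then e i else one).
  rewrite /x /y; case: (a) (b) => [] [] /=;
    by rewrite ?andbF ?andbT ?sgn0 ?sm_mul1x ?sm_mulx1 ?sig_e.
rewrite -sm_mulA (sm_mulA (gprod_from e i.+1 p)) py -!sm_mulA IH //.
rewrite [y * _]sgnCA sgnDA sgnCA [x * _]sm_mulA xy -!sm_mulA !sgnDA.
by rewrite [_ (+) [&& _, _ & _]]addbC addbA.
Qed.

Lemma gprod_sq p : within o (size p) ->
  gprod e p * gprod e p = sgn (cocycle s 0 p p).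
Proof.
move=> le_p; rewrite /gprod gprod_from_mul // gprod_from_zero ?sm_mulx1 //.
by rewrite has_xors_self.
Qed.

Lemma span_gen i : within o i.+1 -> span o e (e i).
Proof.
move=> i_o; exists false, (rcons (nseq i false) true).
by rewrite size_rcons size_nseq sgn0 /gprod gprod_from_single.
Qed.

Lemma span_sgn b : span o e (sgn b).
Proof. by exists b, [::]; rewrite sm_mulx1; case: o. Qed.

Lemma spanM x y : span o e x -> span o e y -> span o e (x * y).
Proof.
move=> [b [p [le_p ->]]] [c [q [le_q ->]]].
exists (b (+) c (+) cocycle s 0 p q), (xors p q); split.
  by rewrite size_xors within_max.
by rewrite sgnCA -!sm_mulA [gprod e p * _]gprod_from_mul // !sgnDA [c (+) b]addbC.
Qed.

Lemma span_min (P : M -> Prop) x : P one -> P m ->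
  (forall y z, P y -> P z -> P (y * z)) ->
  (forall i, within o i.+1 -> P (e i)) -> span o e x -> P x.
Proof.
move=> P1 Pm PM Pe [b [p [le_p ->]]]; apply: (PM); first by case: b.
rewrite /gprod; rewrite -[size p]add0n in le_p; elim: p 0 le_p => //= a p IH i.
rewrite -addSnnS => le_p.
apply: (PM); last exact: IH.
by case: a => //; apply: Pe; apply: within_leq le_p; rewrite leq_addr.
Qed.

(** In place of a cancellation law, multiplying by [e^p], whose square is a sign, reduces the
    equation to signs. *)
Lemma gprod_sgn_inj a b p : within o (size p) ->
  sgn a * gprod e p = sgn b * gprod e p -> a = b.
Proof.
move=> le_p /(congr1 (fun x => x * gprod e p)); rewrite -!sm_mulA gprod_sq //.
by rewrite !sgnD => /sgn_inj/addIb.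
Qed.

(** Multiplying the equation by [e^q] shows that [e^(p xor q)] is a sign, which basicness forbids
    unless [p xor q] vanishes. *)
Lemma basic_inj b c p q : basic o e ->
  within o (size p) -> within o (size q) ->
  sgn b * gprod e p = sgn c * gprod e q -> b = c /\ ~~ has id (xors p q).
Proof.
move=> basic_e le_p le_q eq_pq.
have pq0 : ~~ has id (xors p q).
  apply/negP => /basic_e; rewrite size_xors within_max // => /(_ isT).
  have: gprod e (xors p q) =
      sgn (cocycle s 0 p q (+) b (+) c (+) cocycle s 0 q q).
    rewrite -sgnD -gprod_sq // -sgnD -sm_mulA [sgn c * _]sm_mulA -eq_pq.
    rewrite -!sm_mulA (sgnDA _ b) -addbA addbb addbF.
    by rewrite [gprod e p * _]gprod_from_mul // sgnDA addbb sgn0.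
  by move=> ->; case: (_ (+) _) => -[].
split=> //; move: eq_pq; rewrite {2}/gprod -(gprod_from_xors e 0 pq0).
exact: gprod_sgn_inj.
Qed.

End Products.

Lemma span_size n e x : span (Some n) e x ->
  exists b p, size p = n /\ x = sgn b * gprod e p.
Proof.
move=> [b [p [/= le_p ->]]]; exists b, (p ++ nseq (n - size p) false).
by rewrite size_cat size_nseq subnKC // /gprod gprod_from_pad.
Qed.

(* Pigeonhole: the elements of [G/{1,-1}] are parametrized bijectively by the
   [2^n] exponents of [e] and surjectively by those of [f]. *)
Lemma basic_of_span_fin n e f s : generator (Some n) e ->
  signature (Some n) e s -> (forall x, span (Some n) f x) -> basic (Some n) f.
Proof.
move=> [basic_e _ anti_e] sig_e span_f.
pose R p r := size r = n /\ exists b, gprod e p = sgn b * gprod f r.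
have exR p : exists r, R p r.
  by have [b [r [sz_r eq_r]]] := span_size (span_f (gprod e p)); exists r; split; last exists b.
pose phi p := sval (constructive_indefinite_description _ (exR p)).
have phiP p : R p (phi p) by rewrite /phi; case: constructive_indefinite_description.
have same p q c : size p = n -> size q = n ->
    gprod f (phi p) = sgn c * gprod f (phi q) -> p = q.
  move=> sz_p sz_q eq_f; have [_ [a eq_p]] := phiP p; have [_ [b eq_q]] := phiP q.
  have eq_pq : sgn (a (+) c) * gprod e q = sgn b * gprod e p.
    by rewrite eq_p eq_f eq_q !sgnDA; congr (sgn _ * _); case: a b c {eq_f eq_p eq_q} => [] [] [].
  have [||_ ] := basic_inj anti_e sig_e basic_e _ _ eq_pq; rewrite /= ?sz_p ?sz_q //.
  by rewrite xorsC; apply: xors_eq; rewrite sz_p sz_q.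
have phi_uniq : uniq (map phi (bseqs n)).
  rewrite map_inj_in_uniq ?uniq_bseqs // => p q; rewrite !mem_bseqs.
  by move=> /eqP sz_p /eqP sz_q eq_pq; apply: (same p q false) => //; rewrite eq_pq sgn0.
have phi_sub : {subset map phi (bseqs n) <= bseqs n}.
  by move=> _ /mapP[p _ ->]; rewrite mem_bseqs; have [-> _] := phiP p.
have [_ phi_onto] := uniq_min_size phi_uniq phi_sub (eq_leq (esym (size_map phi _))).
have onto r : size r = n -> exists2 p, size p = n & phi p = r.
  move=> sz_r; have: r \in bseqs n by rewrite mem_bseqs sz_r.
  by rewrite -phi_onto => /mapP[p]; rewrite mem_bseqs => /eqP ? ->; exists p.
(* If [f^r] is a sign, the padded [r] and the zero sequence give the same element up to sign, so
   their preimages under [phi] coincide and [r] is zero. *)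
have [p0 sz_p0 phi_p0] := onto (nseq n false) (size_nseq _ _).
move=> r /= le_r has_r; pose r' := r ++ nseq (n - size r) false.
have sz_r' : size r' = n by rewrite size_cat size_nseq subnKC.
have [p1 sz_p1 phi_p1] := onto r' sz_r'.
suff no c : gprod f r <> sgn c by split; [apply: (no false)|apply: (no true)].
move=> eq_r; have p10 : p1 = p0.
  apply: (same _ _ c) => //; rewrite phi_p0 phi_p1 /gprod gprod_from_pad.
  by rewrite (@gprod_from_zero f 0 (nseq _ _)) ?has_nseq ?andbF // sm_mulx1.
move: has_r; have: has id r' = false by rewrite -phi_p1 p10 phi_p0 has_nseq andbF.
by rewrite has_cat => /norP[/negPf->].
Qed.

(* A product of terms of [f] that is central commutes with every [f i]; the
   terms [f i] beyond its support show that it has an even number of factors,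
   and the remaining ones that it has none. *)
Lemma basic_of_anticommutative f s : anticommutative None f ->
  signature None f s -> basic None f.
Proof.
move=> anti_f sig_f p _ has_p.
suff no c : gprod f p <> sgn c by split; [apply: (no false)|apply: (no true)].
move=> eq_p; have comm j : odd (count id p) = nth false p j.
  have := @skew_gprod_from None f anti_f 0 j p isT isT.
  rewrite /= subn0 -/(gprod f p) eq_p /skew -sgnC -{1}[sgn c * f j]sgn0.
  move=> /(congr1 (fun x => x * f j)); rewrite -!sm_mulA sig_f // !sgnD.
  by move=> /sgn_inj/addIb /esym; case: (odd _) (nth _ _ _) => [] [].
have /(nthP false)[j _ nth_j] : true \in p by case/hasP: has_p => -[].
by move: (comm j) (comm (size p)); rewrite nth_j nth_default // => ->.
Qed.

(** For a change of generator it suffices to recover the old terms from the new ones: basicness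
    comes from the pigeonhole principle or, for infinite length, from anticommutation. *)
Lemma generator_of_span o e f s s' : generator o e -> signature o e s ->
  anticommutative o f -> signature o f s' ->
  (forall i, within o i.+1 -> span o f (e i)) -> generator o f.
Proof.
move=> gen_e sig_e anti_f sig_f span_e.
have span_f x : span o f x.
  have [_ gen _] := gen_e; apply: (@span_min o e) (gen x) => //.
  - exact: (span_sgn o f false).
  - exact: (span_sgn o f true).
  - by move=> y z; apply: spanM anti_f sig_f _ _.
split=> //; case: o gen_e sig_e anti_f sig_f span_f {span_e} => [n|] gen_e sig_e anti_f sig_f span_f.
  exact: basic_of_span_fin gen_e sig_e span_f.
exact: basic_of_anticommutative anti_f sig_f.
Qed.

End SignedMonoid.

Implicit Types M N : signed_monoid.

(** * Isomorphism of structures with equal signatures *)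

Definition has_generator o s (M : signed_monoid) :=
  exists e : nat -> M, generator o e /\ signature o e s.

Definition monoid_iso (M N : signed_monoid) := exists phi : M -> N,
  [/\ bijective phi, forall x y, phi (x * y)%sm = (phi x * phi y)%sm &
      phi (sm_m M) = sm_m N].

(** A relation, because exponent lists of an element differ by trailing zeros; [transport_fun] makes
    it a function. *)
Definition transport o (M N : signed_monoid) (e : nat -> M) (f : nat -> N) x y :=
  exists b p, [/\ within o (size p), x = (sgn M b * gprod e p)%sm &
    y = (sgn N b * gprod f p)%sm].

Lemma transport_sym o M N (e : nat -> M) (f : nat -> N) x y :
  transport o e f x y -> transport o f e y x.
Proof. by case=> b [p [? ? ?]]; exists b, p. Qed.

Lemma transport_fun o s M N (e : nat -> M) (f : nat -> N) x y y' :
  generator o e -> signature o e s ->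
  transport o e f x y -> transport o e f x y' -> y = y'.
Proof.
move=> [basic_e _ anti_e] sig_e [b [p [le_p -> ->]]] [c [q [le_q eq_pq ->]]].
have [-> pq] := basic_inj anti_e sig_e basic_e le_p le_q eq_pq.
by rewrite /gprod (gprod_from_xors f 0 pq).
Qed.

Lemma transportM o s M N (e : nat -> M) (f : nat -> N) x x' y y' :
  anticommutative o e -> anticommutative o f ->
  signature o e s -> signature o f s ->
  transport o e f x y -> transport o e f x' y' ->
  transport o e f (x * x')%sm (y * y')%sm.
Proof.
move=> anti_e anti_f sig_e sig_f [b [p [le_p -> ->]]] [c [q [le_q -> ->]]].
exists (b (+) c (+) cocycle s 0 p q), (xors p q).
rewrite size_xors within_max // ![(_ * (sgn _ c * _))%sm]sgnCA -!sm_mulA /gprod.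
rewrite (gprod_from_mul anti_e sig_e) // (gprod_from_mul anti_f sig_f) //.
by rewrite !sgnDA [c (+) b]addbC.
Qed.

(** The sign in [gprod_from_mul] depends on the signatures alone, so matching [e^p] with [f^p]
    respects products. *)
Lemma iso_of_signature o s M N :
  has_generator o s M -> has_generator o s N -> monoid_iso M N.
Proof.
move=> [e [gen_e sig_e]] [f [gen_f sig_f]].
have [_ span_e anti_e] := gen_e; have [_ span_f anti_f] := gen_f.
have exT x : exists y, transport o e f x y.
  by have [b [p [? ?]]] := span_e x; exists (sgn N b * gprod f p)%sm, b, p.
have exT' y : exists x, transport o f e y x.
  by have [b [p [? ?]]] := span_f y; exists (sgn M b * gprod e p)%sm, b, p.
pose phi x := sval (constructive_indefinite_description _ (exT x)).
have phiP x : transport o e f x (phi x) by rewrite /phi; case: constructive_indefinite_description.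
pose psi y := sval (constructive_indefinite_description _ (exT' y)).
have psiP y : transport o f e y (psi y) by rewrite /psi; case: constructive_indefinite_description.
exists phi; split.
- exists psi => [x|y].
    exact: transport_fun gen_f sig_f (psiP _) (transport_sym (phiP x)).
  exact: transport_fun gen_e sig_e (phiP _) (transport_sym (psiP y)).
- move=> x y; apply: (transport_fun gen_e sig_e (phiP _)).
  exact: transportM anti_e anti_f sig_e sig_f (phiP x) (phiP y).
- apply: (transport_fun gen_e sig_e (phiP _)).
  by exists true, [::]; rewrite /= within0 !sm_mulx1.
Qed.

(** * Changes of generator *)

Section Moves.
Variable M : signed_monoid.
Local Open Scope sm_scope.
Local Notation one := (sm_one M).

Lemma has_generator_perm n (sigma : 'S_n) (s t : nat -> bool) :
  (forall i : 'I_n, t i = s (sigma i)) ->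
  has_generator (Some n) s M -> has_generator (Some n) t M.
Proof.
move=> t_s [e [gen_e sig_e]]; have [_ _ anti_e] := gen_e.
pose f i := if insub i is Some j then e (sigma j) else e 0.
have fE (i : 'I_n) : f i = e (sigma i) by rewrite /f valK.
have sig_f : signature (Some n) f t.
  by move=> i i_n; rewrite (fE (Ordinal i_n)) (t_s (Ordinal i_n)) sig_e /=.
have anti_f : anticommutative (Some n) f.
  move=> i j i_n j_n ij; rewrite (fE (Ordinal i_n)) (fE (Ordinal j_n)).
  by apply: anti_e => //=; move=> /val_inj/perm_inj[].
exists f; split=> //; apply: (generator_of_span gen_e sig_e anti_f sig_f).
move=> i i_n; rewrite -[i]/(val (Ordinal i_n)) -[Ordinal i_n](permKV sigma) -fE.
by apply: span_gen; rewrite /= ltn_ord.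
Qed.

(* Multiplying the other terms by a term of positive signature. *)
Lemma has_generator_twist o s i0 : within o i0.+1 -> s i0 = false ->
  has_generator o s M ->
  has_generator o (fun i => (i != i0) && ~~ s i) M.
Proof.
move=> i0_o s_i0 [e [gen_e sig_e]]; have [_ _ anti_e] := gen_e.
pose f i := if i == i0 then e i0 else e i0 * e i.
have sk i : within o i.+1 -> i != i0 -> skew true (e i0) (e i).
  by move=> i_o /eqP ii0; apply: anti_e => // /esym.
have sig_f : signature o f (fun i => (i != i0) && ~~ s i).
  move=> i i_o; rewrite /f; case: eqP => [->|/eqP ii0]; first by rewrite sig_e ?s_i0.
  by rewrite (sq_mul (sk _ i_o ii0)) !sig_e // !sgnD s_i0.
have anti_f : anticommutative o f.
  move=> i j i_o j_o ij; rewrite /f.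
  case: (i =P i0) => [ii0|/eqP ii0]; case: (j =P i0) => [jj0|/eqP jj0].
  - by case: ij; rewrite ii0 jj0.
  - exact: skewMr (skew_refl _) (sk _ j_o jj0).
  - exact/skew_sym/(skewMr (skew_refl _) (sk _ i_o ii0)).
  - have ski := skewMr (skew_refl (e i0)) (sk _ j_o jj0).
    have skj := skewMr (skew_sym (sk _ i_o ii0)) (anti_e i j i_o j_o ij).
    exact: skewM ski skj.
exists f; split=> //; apply: (generator_of_span gen_e sig_e anti_f sig_f).
move=> i i_o; have f_i0 : span o f (e i0).
  by have := span_gen f i0_o; rewrite /f eqxx.
have [->//|ii0] := eqVneq i i0.
have -> : e i = e i0 * f i by rewrite /f (negPf ii0) sm_mulA sig_e // s_i0 sm_mul1x.
exact: spanM anti_f sig_f _ _ f_i0 (span_gen _ i_o).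
Qed.

(* The indices in [S] are numbered by [r] and grouped into quadruples of
   consecutive numbers; multiplying the terms of each quadruple by their product
   [w] flips their signatures, because [w] has signature [+] and anticommutes
   exactly with its own four factors. *)
Lemma has_generator_flip o s v (S T : pred nat) (r : nat -> nat) :
  (forall i, S i -> [/\ within o i.+1, s i = v & T (r i)]) ->
  {in S &, injective r} ->
  (forall x, T x -> exists2 i, S i & r i = x) ->
  (forall b y y', y < 4 -> y' < 4 -> T (4 * b + y)%N -> T (4 * b + y')%N) ->
  has_generator o s M -> has_generator o (fun i => S i (+) s i) M.
Proof.
move=> SP r_inj r_onto T_blk [e [gen_e sig_e]]; have [_ _ anti_e] := gen_e.
(* [t] inverts [r] on [T]. *)
pose t x := epsilon (inhabits 0) (fun i => S i /\ r i = x).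
have tP x : T x -> S (t x) /\ r (t x) = x.
  move=> /r_onto[i Si ri].
  by apply: (epsilon_spec (inhabits 0) (fun i => S i /\ r i = x)); exists i.
have to x : T x -> within o (t x).+1 by move=> /tP[/SP[]].
have ts x : T x -> s (t x) = v by move=> /tP[/SP[]].
have tr i : S i -> t (r i) = i.
  by move=> Si; have [_ _ /tP[St]] := SP i Si; apply: r_inj.
pose w b := e (t (4 * b)%N) * e (t (4 * b + 1)%N) *
            (e (t (4 * b + 2)%N) * e (t (4 * b + 3)%N)).
have T4 b : T (4 * b)%N ->
    [/\ T (4 * b)%N, T (4 * b + 1)%N, T (4 * b + 2)%N & T (4 * b + 3)%N].
  move=> Tb; have T4b0 : T (4 * b + 0)%N by rewrite addn0.
  by split=> //; apply: T_blk T4b0.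
have skt x j : T x -> within o j.+1 -> skew (~~ (S j && (r j == x))) (e j) (e (t x)).
  move=> Tx j_o; have [St rt] := tP x Tx.
  case: (boolP (S j && (r j == x))) => [/andP[Sj /eqP <-]|nj].
    by rewrite tr //; exact: skew_refl.
  apply: (anti_e _ _ j_o (to _ Tx)).
  by move=> jt; move: nj; rewrite jt St rt eqxx.
have sktt x y : T x -> T y -> x != y -> skew true (e (t x)) (e (t y)).
  move=> Tx Ty xy; have := skt y (t x) Ty (to x Tx).
  by have [-> ->] := tP x Tx; rewrite (negPf xy).
have skw b j : T (4 * b)%N -> within o j.+1 ->
    skew (S j && (r j %/ 4 == b)) (e j) (w b).
  move=> /T4[T0 T1 T2 T3] j_o.
  have := skewMr (skewMr (skt _ _ T0 j_o) (skt _ _ T1 j_o))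
                 (skewMr (skt _ _ T2 j_o) (skt _ _ T3 j_o)).
  (* A term anticommutes with all four factors of [w b], unless it is one of them and anticommutes
     with the other three. *)
  congr (skew _ _ _); case: (S j) => //=.
  do 4![case: eqP => ? /=]; case: eqP => ? //=; lia.
have ww b c : T (4 * b)%N -> T (4 * c)%N -> skew false (w b) (w c).
  move=> Tb Tc; have [->|bc] := eqVneq b c; first exact: skew_refl.
  have ew y : y < 4 -> T (4 * b + y)%N -> skew false (e (t (4 * b + y)%N)) (w c).
    move=> y4 Ty; have := skw c (t (4 * b + y)%N) Tc (to _ Ty).
    have [-> ->] := tP _ Ty; congr (skew _ _ _).
    by rewrite mulnC divnMDl // divn_small // addn0 (negPf bc).
  have [T0 T1 T2 T3] := T4 b Tb.
  have ew0 : skew false (e (t (4 * b)%N)) (w c) by have := ew 0; rewrite addn0; exact.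
  exact: (skewM (skewM ew0 (ew 1 isT T1)) (skewM (ew 2 isT T2) (ew 3 isT T3))).
have w_sq b : T (4 * b)%N -> w b * w b = one.
  move=> /T4[T0 T1 T2 T3]; rewrite /w.
  have ne k l : k != l -> (4 * b + k != 4 * b + l)%N by rewrite eqn_add2l.
  have ne0 l : 0 != l -> (4 * b != 4 * b + l)%N by move=> /ne; rewrite addn0.
  (* The two pairs commute; each squared pair carries a sign -1, and these two cancel, as do the
     four equal signatures. *)
  rewrite (sq_mul (skewM (skewMr (sktt _ _ T0 T2 (ne0 2 isT)) (sktt _ _ T0 T3 (ne0 3 isT)))
    (skewMr (sktt _ _ T1 T2 (ne 1 2 isT)) (sktt _ _ T1 T3 (ne 1 3 isT))))).
  rewrite (sq_mul (sktt _ _ T0 T1 (ne0 1 isT))) (sq_mul (sktt _ _ T2 T3 (ne 2 3 isT))).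
  rewrite !sig_e ?to // !ts // !sgnD; by case: v {SP ts}.
pose f i := if S i then w (r i %/ 4) * e i else e i.
have Tr i : S i -> T (4 * (r i %/ 4))%N.
  move=> Si; have [_ _] := SP i Si; rewrite {1}(divn_eq (r i) 4) mulnC => Ti.
  by have := T_blk _ _ 0 (@ltn_pmod (r i) 4 isT) isT Ti; rewrite addn0.
have we i : S i -> within o i.+1 -> skew true (w (r i %/ 4)) (e i).
  by move=> Si i_o; have := skew_sym (skw _ _ (Tr _ Si) i_o); rewrite Si eqxx.
have sig_f : signature o f (fun i => S i (+) s i).
  move=> i i_o; rewrite /f; case: ifP => Si; last by rewrite sig_e.
  by rewrite (sq_mul (we _ Si i_o)) w_sq ?Tr // sig_e // sm_mul1x sgnD.
have anti_f : anticommutative o f.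
  move=> i j i_o j_o ij; have eij := anti_e i j i_o j_o ij; rewrite /f.
  case: ifP => Si; case: ifP => Sj //.
  - have wij := ww _ _ (Tr i Si) (Tr j Sj).
    have wej := skew_sym (skw _ _ (Tr i Si) j_o).
    have eiw := skw _ _ (Tr j Sj) i_o.
    (* The two mixed signs, [w] against the other term, are equal and cancel. *)
    have := skewM (skewMr wij wej) (skewMr eiw eij).
    by rewrite Si Sj [r j %/ 4 == _]eq_sym; case: eqP.
  - have wej := skew_sym (skw _ _ (Tr i Si) j_o).
    by have := skewM wej eij; rewrite Sj.
  - have eiw := skw _ _ (Tr j Sj) i_o.
    by have := skewMr eiw eij; rewrite Si.
exists f; split=> //; apply: (generator_of_span gen_e sig_e anti_f sig_f).
move=> i i_o; have [Si|nSi] := boolP (S i); last first.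
  by have := span_gen f i_o; rewrite {2}/f (negPf nSi).
have fM x y z : skew true x y -> x * x = one -> x * y * (x * z) = sgn M true * (y * z).
  move=> xy xx; rewrite -sm_mulA [y * _]sm_mulA (skew_sym xy).
  by rewrite -!sm_mulA sgnCA (sm_mulA x x) xx sm_mul1x.
suff span_w : span o f (w (r i %/ 4)).
  have -> : e i = w (r i %/ 4) * f i by rewrite /f Si sm_mulA w_sq ?Tr // sm_mul1x.
  exact: spanM anti_f sig_f _ _ span_w (span_gen _ i_o).
move: (r i %/ 4) (Tr i Si) => b Tb; have [T0 T1 T2 T3] := T4 b Tb.
have ft y : y < 4 -> T (4 * b + y)%N ->
    f (t (4 * b + y)%N) = w b * e (t (4 * b + y)%N) /\ skew true (w b) (e (t (4 * b + y)%N)).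
  move=> y4 Ty; have [St rt] := tP _ Ty.
  have rb : r (t (4 * b + y)%N) %/ 4 = b.
    by rewrite rt mulnC divnMDl // divn_small // addn0.
  by rewrite /f St rb; split=> //; have := we _ St (to _ Ty); rewrite rb.
have [f0 wt0] : f (t (4 * b)%N) = w b * e (t (4 * b)%N) /\ skew true (w b) (e (t (4 * b)%N)).
  by have := ft 0; rewrite addn0; exact.
have [f1 _] := ft 1 isT T1; have [f2 wt2] := ft 2 isT T2; have [f3 _] := ft 3 isT T3.
(* Within each pair the two factors [w b] cancel at the cost of a sign -1, and the two signs
   cancel. *)
have -> : w b = f (t (4 * b)%N) * f (t (4 * b + 1)%N) *
    (f (t (4 * b + 2)%N) * f (t (4 * b + 3)%N)).
  rewrite f0 f1 f2 f3 (fM _ _ _ wt0) ?w_sq // (fM _ _ _ wt2) ?w_sq //.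
  by rewrite sgnCA -sm_mulA sgnDA sgn0.
by do !apply: (spanM anti_f sig_f); apply: span_gen; apply: to.
Qed.

End Moves.

Implicit Types (s : nat -> bool).

Lemma eq_has_generator o s t M : (forall i, within o i.+1 -> s i = t i) ->
  has_generator o s M -> has_generator o t M.
Proof.
move=> st [e [gen_e sig_e]]; exists e; split=> // i i_o.
by rewrite sig_e // st.
Qed.

(** * The number of negative signatures, for finite length *)

(** As a function of [n] it also ranks the indices satisfying [s], and so supplies the numbering [r]
    of [has_generator_flip]. *)
Definition negs (s : nat -> bool) n := count s (iota 0 n).

Lemma negsS s n : negs s n.+1 = negs s n + s n.
Proof. by rewrite /negs -addn1 iotaD count_cat /= addn0. Qed.

Lemma negs_leq s n : negs s n <= n.
Proof. by rewrite -{2}(size_iota 0 n) count_size. Qed.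

Lemma negs_mono s i j : i <= j -> negs s i <= negs s j.
Proof. by move/subnKC <-; rewrite /negs iotaD count_cat leq_addr. Qed.

Lemma negs_inj s i j : s i -> s j -> negs s i = negs s j -> i = j.
Proof.
have lt a b : s a -> a < b -> negs s a < negs s b.
  by move=> sa /(negs_mono s); rewrite negsS sa addn1.
by move=> si sj; case: (ltngtP i j) => // /lt; [move/(_ si) | move/(_ sj)]; lia.
Qed.

Lemma negs_onto s n x : x < negs s n -> exists i, [/\ i < n, s i & negs s i = x].
Proof.
elim: n => // n IH; rewrite negsS => lt_x.
have [/IH[i [i_n si <-]]|ge_x] := ltnP x (negs s n).
  by exists i; rewrite ltnW.
by exists n; move: lt_x; case: (s n) => lt_x; split=> //; lia.
Qed.

Lemma negs_perm s (t : nat -> bool) n : negs s n = negs t n ->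
  exists sigma : 'S_n, forall i : 'I_n, t i = s (sigma i).
Proof.
move=> st; have /tuple_permP[sigma eq_t] :
    perm_eq (map t (iota 0 n)) (map_tuple s (iota_tuple n 0)).
  apply/allP => b _ /=; rewrite !count_map; apply/eqP.
  have tE : count (preim t (pred1 true)) (iota 0 n) = negs t n.
    by apply: eq_count => i /=; case: (t i).
  have sE : count (preim s (pred1 true)) (iota 0 n) = negs s n.
    by apply: eq_count => i /=; case: (s i).
  case: b; first by rewrite tE sE.
  have fE u : count (preim u (pred1 false)) (iota 0 n) = n - negs u n.
    rewrite -{2}(size_iota 0 n) -(count_predC u) addKn.
    by apply: eq_count => i /=; case: (u i).
  by rewrite !fE st.
exists sigma => i; have := congr1 (nth false ^~ i) eq_t.
rewrite (nth_map 0) ?size_iota // nth_iota // => ->.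
rewrite -(tnth_nth false [tuple of _]) /= tnth_mktuple (tnth_nth false) /=.
by rewrite (nth_map 0) ?size_iota // nth_iota.
Qed.

Definition has_negs n k M :=
  exists2 s, has_generator (Some n) s M & negs s n = k.

Lemma iso_of_negs n k M N : has_negs n k M -> has_negs n k N -> monoid_iso M N.
Proof.
move=> [s gen_s <-] [t gen_t /esym/negs_perm[sigma ts]].
exact: iso_of_signature (has_generator_perm ts gen_s) gen_t.
Qed.

Lemma has_negs_twist n k M : k < n -> has_negs n k M -> has_negs n (n.-1 - k) M.
Proof.
move=> lt_k [s gen_s sk].
have /negs_onto[i0 [i0_n /negPf s_i0 _]] : 0 < negs (predC s) n.
  by rewrite -(ltn_add2l (negs s n)) addn0 /negs count_predC size_iota -/(negs s n) sk.
pose s' (i : nat) := (i != i0) && ~~ s i; exists s'.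
  exact: has_generator_twist gen_s.
(* Each index is negative before, negative after, or [i0]; the indicator of [i0 < n] lets the
   induction start below [i0]. *)
suff: negs s' n + negs s n + (i0 < n) = n by rewrite i0_n sk; lia.
elim: n {lt_k gen_s sk i0_n} => // n; rewrite !negsS {3}/s' ltnS.
by case: (ltngtP n i0) => [||->]; rewrite ?s_i0 => *; [case: (s n); lia..|lia].
Qed.

Lemma has_negs_sub4 n k M : 4 <= k -> has_negs n k M -> has_negs n (k - 4) M.
Proof.
(* [S] holds the first four negative indices, which form a single block. *)
move=> k4 [s gen_s sk]; pose S i := [&& s i, i < n & negs s i < 4].
exists (fun i => S i (+) s i).
  apply: (@has_generator_flip M (Some n) s true S (gtn 4) (negs s)) gen_s.
  - by move=> i /and3P[].
  - by move=> i j /and3P[si _ _] /and3P[sj _ _]; exact: negs_inj.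
  - move=> x x4; have [i [i_n si six]] : exists i, [/\ i < n, s i & negs s i = x].
      by apply: negs_onto; rewrite sk (leq_trans x4).
    by exists i => //; apply/and3P; rewrite six.
  - by move=> b y y' _ /=; case: b; lia.
suff minE i : i <= n -> negs (fun i => S i (+) s i) i + minn 4 (negs s i) = negs s i.
  by have := minE n (leqnn n); rewrite sk (minn_idPl k4); lia.
elim: i => [|i IH] i_n; first by rewrite /negs.
have := IH (ltnW i_n); rewrite !negsS /S i_n /=.
by case: (s i) => /=; case: ltnP => /=; lia.
Qed.

(* Only [k] modulo 4 matters, up to exchanging [k] and [n - 1 - k]; the values
   just above [n / 2] represent all classes. *)
Lemma has_negs_reduce n k M : 1 < n -> k <= n -> has_negs n k M ->
  [\/ has_negs n n./2 M, has_negs n n./2.+1 M | odd n /\ has_negs n n./2.+2 M].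
Proof.
move=> n_gt1 k_n negs_k; have n2 := odd_double_half n; rewrite -addnn in n2.
have twist l l' : l + l' = n.-1 -> has_negs n l M -> has_negs n l' M.
  by move=> ll' /has_negs_twist; rewrite -ll' addKn; apply; lia.
have upper c l : n./2 <= l -> l <= n -> l <= c -> has_negs n l M ->
    [\/ has_negs n n./2 M, has_negs n n./2.+1 M | odd n /\ has_negs n n./2.+2 M].
  elim: c l => [|c IH] l l_ge l_n l_c negs_l; first by constructor 1; rewrite (_ : n./2 = l) //; lia.
  have [ge4|lt4] := leqP (n./2 + 4) l.
    by apply: (IH (l - 4)); [lia..|apply: has_negs_sub4 negs_l; lia].
  have [->|l0] := eqVneq n./2 l; first by constructor 1.
  have [->|l1] := eqVneq n./2.+1 l; first by constructor 2.
  (* Apart from [n./2.+2] with [n] odd, which is its own class, subtracting 4 and reflecting by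
     [twist] leads to [n./2] or [n./2.+1]. *)
  have negs_l4 : 4 <= l -> has_negs n (l - 4) M by move=> l4; apply: has_negs_sub4.
  have [l2|l2] := eqVneq n./2.+2 l.
    case: (boolP (odd n)) => [odd_n|even_n]; first by constructor 3; rewrite l2.
    by constructor 2; apply: (twist (l - 4)); [lia|apply: negs_l4; lia].
  case: (boolP (odd n)) => odd_n.
    by constructor 2; apply: (twist (l - 4)); [lia|apply: negs_l4; lia].
  by constructor 1; apply: (twist (l - 4)); [lia|apply: negs_l4; lia].
have [ge|lt] := leqP n./2 k; first exact: (upper k k).
by apply: (upper n (n.-1 - k)%N); [lia..|apply: has_negs_twist negs_k; lia].
Qed.

(** * Infinite length *)

(** The ranks of infinitely many indices exhaust the naturals, so every block of four is
    complete. *)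
Lemma has_generator_flip_all s v M : (forall x, exists n, x < negs (fun i => s i == v) n) ->
  has_generator None s M -> has_generator None (fun=> ~~ v) M.
Proof.
move=> unb gen_s; apply: eq_has_generator (has_generator_flip (v := v)
    (S := fun i => s i == v) (T := predT) (r := negs (fun i => s i == v)) _ _ _ _ gen_s) => //.
- by move=> i _; case: (s i) (v) => [] [].
- by move=> i /eqP.
- by move=> i j si sj; exact: (@negs_inj (fun i => s i == v)).
- by move=> x _; have [n /negs_onto[i [_ si <-]]] := unb x; exists i.
Qed.

(** If only finitely many signatures are -1, flipping the others makes all of them -1, and a second
    flip makes all of them +1. *)
Lemma has_generator_positive s M :
  has_generator None s M -> has_generator None (fun=> false) M.
Proof.
move=> gen_s; have [unb|bnd] := classic (forall x, exists n, x < negs (fun i => s i == true) n).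
  exact: has_generator_flip_all unb gen_s.
have [x bnd_x] : exists x, forall n, negs (fun i => s i == true) n <= x.
  apply: NNPP => nx; apply: bnd => x; apply: NNPP => nn; apply: nx; exists x => n.
  by rewrite leqNgt; apply/negP => lt; apply: nn; exists n.
have gen_m : has_generator None (fun=> true) M.
  (* At most [x] of the first [x + y + 1] signatures are -1, so more than [y] are +1. *)
  apply: (has_generator_flip_all (v := false)) gen_s => y; exists (x + y).+1.
  have split_n n : negs (fun i => s i == true) n + negs (fun i => s i == false) n = n.
    by elim: n => // n IH; rewrite !negsS; case: (s n) => /=; lia.
  by have := split_n (x + y).+1; have := bnd_x (x + y).+1; lia.
apply: (has_generator_flip_all (v := true)) gen_m => y; exists y.+1.
by rewrite /negs (@eq_count _ _ predT) // count_predT size_iota.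
Qed.

Lemma iso_of_infinite s t M N :
  has_generator None s M -> has_generator None t N -> monoid_iso M N.
Proof.
by move=> /has_generator_positive gen_M /has_generator_positive; exact: iso_of_signature.
Qed.

(** * Realization of signatures by operators *)

Section Operators.
Local Notation op := ((nat -> bool) -> bool * (nat -> bool)).

(** Bit sequences label basis vectors; an operator sends each to a basis vector with a sign, and
    this is composition. *)
Definition op_mul (f g : op) : op :=
  fun x => ((g x).1 (+) (f (g x).2).1, (f (g x).2).2).

Program Definition operators : signed_monoid :=
  @SignedMonoid op op_mul (pair false) (pair true) _ _ _ _ _ _.
Next Obligation.
by apply: functional_extensionality => u; rewrite /op_mul /= addbA.
Qed.
Next Obligation.
by apply: functional_extensionality => u; rewrite /op_mul /= addbF -surjective_pairing.
Qed.
Next Obligation.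
by apply: functional_extensionality => u; rewrite /op_mul /= -surjective_pairing.
Qed.
Next Obligation.
by move=> /(congr1 (fun f => (f xpred0).1)).
Qed.
Next Obligation.
by apply: functional_extensionality => u; rewrite /op_mul /= addbT.
Qed.

(* Jordan-Wigner operators: [jw s i] flips bit [i], with the sign given by the
   parity of the preceding bits, twisted by bit [i] when the signature is [-1]. *)
Definition jw (s : nat -> bool) (i : nat) : operators :=
  fun x => (odd (count x (iota 0 i)) (+) (s i && x i), fun j => x j (+) (j == i)).

Lemma count_flip (x : nat -> bool) i j : j <= i ->
  count (fun k => x k (+) (k == i)) (iota 0 j) = count x (iota 0 j).
Proof.
move=> ji; apply: eq_in_count => k; rewrite mem_iota add0n /= => kj.
by rewrite ltn_eqF ?addbF // (leq_trans kj).
Qed.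

Lemma jw_signature o s : signature o (jw s) s.
Proof.
move=> i _; apply: functional_extensionality => x /=; rewrite /op_mul /=.
have -> : (fun j => (x j (+) (j == i)) (+) (j == i)) = x.
  by apply: functional_extensionality => j; rewrite -addbA addbb addbF.
rewrite count_flip // eqxx.
by case: (odd _) (s i) (x i) => [] [] [].
Qed.

(** For [i < j], flipping bit [i] changes the parity that [jw s j] reads, while flipping bit [j]
    changes nothing that [jw s i] reads. *)
Lemma jw_anticommutative o s : anticommutative o (jw s).
Proof.
suff lt i j : i < j -> skew true (jw s i) (jw s j).
  by move=> i j _ _ /eqP; rewrite neq_ltn => /orP[/lt//|/lt/skew_sym].
move=> ij; apply: functional_extensionality => x /=; rewrite /op_mul /=.
congr pair; last by apply: functional_extensionality => k; rewrite addbAC.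
rewrite (count_flip _ (ltnW ij)) (ltn_eqF ij) (gtn_eqF ij) !addbF.
have -> : odd (count (fun k => x k (+) (k == i)) (iota 0 j)) = ~~ odd (count x (iota 0 j)).
  elim: j ij => // j IH; rewrite ltnS leq_eqVlt => /orP[/eqP<-|ij].
    by rewrite -addn1 iotaD !count_cat /= count_flip // eqxx !addn0 !oddD !oddb addbT addbN.
  by rewrite -addn1 iotaD !count_cat /= (gtn_eqF ij) addbF !oddD IH // addNb.
by case: (odd _) (odd _) (s i && x i) (s j && x j) => [] [] [] [].
Qed.

Lemma jw_gprod_from s i p x k :
  (gprod_from (jw s) i p x).2 k = x k (+) ((i <= k) && nth false p (k - i)).
Proof.
elim: p i x => [|a p IH] i x /=; first by rewrite nth_nil andbF addbF.
have -> : ((if a then jw s i else pair false) (gprod_from (jw s) i.+1 p x).2).2 k =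
    (gprod_from (jw s) i.+1 p x).2 k (+) (a && (k == i)).
  by case: a => //=; rewrite addbF.
rewrite IH; case: (ltngtP i k) => [ik|ki|<-].
- by rewrite -(subnSK ik) /= andbF addbF.
- by rewrite andbF !addbF.
- by rewrite subnn /= addbF andbT.
Qed.

(** Signs fix every bit sequence, whereas [e^p] flips the bits in the support of [p]. *)
Lemma jw_basic o s : basic o (jw s).
Proof.
move=> p _ /(has_nthP false)[k _ pk].
have := jw_gprod_from s 0 p xpred0 k; rewrite subn0 /= pk -/(gprod (jw s) p).
by move=> gk; split => eq_g; rewrite eq_g in gk.
Qed.

End Operators.

(** * The signed group spanned by an anticommuting sequence *)

Section SpanGroup.
Variables (M : signed_monoid) (o : option nat) (e : nat -> M) (s : nat -> bool).
Hypotheses (anti_e : anticommutative o e) (sig_e : signature o e s).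
Local Open Scope sm_scope.

Definition span_car := {x : M | span o e x}.

Lemma span_car_inj (x y : span_car) : sval x = sval y -> x = y.
Proof.
case: x y => [x px] [y py] /= xy; case: y / xy py => py.
by congr exist; apply: proof_irrelevance.
Qed.

Definition span_mul (x y : span_car) : span_car :=
  exist _ (sval x * sval y) (spanM anti_e sig_e (svalP x) (svalP y)).
Definition span_one : span_car := exist _ (sm_one M) (span_sgn o e false).
Definition span_m : span_car := exist _ (sm_m M) (span_sgn o e true).

Lemma span_skew x y : span o e x -> span o e y -> exists b, skew b x y.
Proof.
move=> [b [p [le_p ->]]] [c [q [le_q ->]]].
exists (cocycle s 0 p q (+) cocycle s 0 q p).
rewrite /skew (sgnCA c) (sgnCA b) -!sm_mulA /gprod !(gprod_from_mul anti_e sig_e) //.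
rewrite (xorsC q).
rewrite !sgnDA; congr (sgn _ _ * _).
by case: b c (cocycle s 0 p q) (cocycle s 0 q p) => [] [] [] [].
Qed.

Lemma span_sq x : span o e x -> exists b, x * x = sgn M b.
Proof.
move=> [b [p [le_p ->]]]; exists (cocycle s 0 p p).
by rewrite sgnCA -!sm_mulA (gprod_sq anti_e sig_e) // sgnDA addbb sgn0.
Qed.

Lemma span_pow4 x : span o e x -> x * x * (x * x) = sm_one M.
Proof. by move=> /span_sq[b ->]; rewrite sgnD addbb. Qed.

(* Every element of the span has order dividing 4, so [x^3] is its inverse. *)
Definition span_group : signed_group.
Proof.
apply: (@SignedGroup span_car span_mul span_one
  (fun x => span_mul x (span_mul x x)) span_m).
- by move=> x y z; apply: span_car_inj; rewrite /= sm_mulA.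
- by move=> x; apply: span_car_inj; rewrite /= sm_mul1x.
- by move=> x; apply: span_car_inj; rewrite /= sm_mulx1.
- move=> x; apply: span_car_inj; rewrite /= -(span_pow4 (svalP x)).
  by rewrite -!sm_mulA.
- move=> x; apply: span_car_inj; rewrite /= -(span_pow4 (svalP x)).
  by rewrite -!sm_mulA.
- by move=> /(congr1 sval)/=; exact: sm_m_neq1.
- by apply: span_car_inj; rewrite /= sm_m_sqr.
- by move=> x; apply: span_car_inj; rewrite /= sm_m_central.
- move=> x y; have [[] xy] := span_skew (svalP x) (svalP y); [right|left];
    by apply: span_car_inj; rewrite /= xy /= ?sm_mul1x.
- move=> x; have [[] xx] := span_sq (svalP x); [right|left];
    exact: span_car_inj.
Defined.
End SpanGroup.

Definition monoid_of_group (G : signed_group) : signed_monoid :=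
  SignedMonoid (@sg_mulA G) (@sg_mul1x G) (@sg_mulx1 G) (@sg_m_neq1 G)
    (@sg_m_sqr G) (@sg_m_central G).

Definition jw_group o s := span_group (@jw_anticommutative o s) (@jw_signature o s).

Lemma jw_group_generator o s : has_generator o s (monoid_of_group (jw_group o s)).
Proof.
(* Beyond the length [jw s i] lies outside the span, and the unit stands in for it. *)
have clip_span i : span o (jw s) (if within o i.+1 then jw s i else sm_one operators).
  by case: ifP => i_o; [exact: span_gen | exact: (span_sgn o (jw s) false)].
pose f i : monoid_of_group (jw_group o s) := exist _ _ (clip_span i).
have fE i : within o i.+1 -> sval (f i) = jw s i by rewrite /= => ->.
have gprodE i p : within o (i + size p) ->
    sval (gprod_from f i p) = gprod_from (jw s) i p.
  move=> le_p; rewrite -(eq_gprod_from fE le_p).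
  by elim: p i {le_p} => //= b p IH i; rewrite IH; case: b.
exists f; split; last first.
  by move=> i i_o; apply: span_car_inj; have := jw_signature s i_o; rewrite /= i_o => ->; case: (s i).
split.
- move=> p le_p has_p; have [n1 nm] := jw_basic s le_p has_p.
  by split=> /(congr1 sval); rewrite gprodE.
- move=> x; have [b [p [le_p eq_x]]] := svalP x; exists b, p; split=> //.
  by apply: span_car_inj; rewrite /= eq_x gprodE //; case: b {eq_x}.
- move=> i j i_o j_o ij; apply: span_car_inj.
  have := @jw_anticommutative o s i j i_o j_o ij; rewrite /= i_o j_o; exact.
Qed.

(** * Counting exponents of square 1 *)

Definition square_count s i n := count (fun p => ~~ cocycle s i p p) (bseqs n).
(* The companion count that closes the recurrence: prepending a term to [p]
   changes the sign of the square by the parity of [p]. *)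
Definition twisted_count s i n :=
  count (fun p => cocycle s i p p == odd (count id p)) (bseqs n).

Lemma size_bseqs n : size (bseqs n) = 2 ^ n.
Proof. by elim: n => //= n IH; rewrite size_cat !size_map IH addnn expnS mul2n. Qed.

Lemma square_countS s i n : square_count s i n.+1 = square_count s i.+1 n +
  (if s i then 2 ^ n - twisted_count s i.+1 n else twisted_count s i.+1 n).
Proof.
rewrite /square_count /twisted_count /= count_cat !count_map addnC; congr (_ + _).
  by apply: eq_count => p /=; rewrite andbF.
rewrite -size_bseqs -(count_predC (fun p => cocycle s i.+1 p p == odd (count id p))) addKn.
by case s_i: (s i); apply: eq_count => p /=; rewrite s_i; case: (odd _) (cocycle _ _ _ _) => [] [].
Qed.

(** A prepended term changes the parity of [p] as well, so the parities cancel and [square_count]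
    returns. *)
Lemma twisted_countS s i n : twisted_count s i n.+1 = twisted_count s i.+1 n +
  (if s i then square_count s i.+1 n else 2 ^ n - square_count s i.+1 n).
Proof.
rewrite /square_count /twisted_count /= count_cat !count_map addnC; congr (_ + _).
  by apply: eq_count => p /=; rewrite andbF.
rewrite -size_bseqs -(count_predC (fun p => ~~ cocycle s i.+1 p p)) addKn.
by case s_i: (s i); apply: eq_count => p /=; rewrite s_i; case: (odd _) (cocycle _ _ _ _) => [] [].
Qed.

(** Two steps with opposite signatures turn equal counts [x] into equal counts [4 ^ j + 2 * x]. *)
Lemma alternating_count s i j : (forall k, i <= k -> s k = odd k) ->
  square_count s i j.*2 * 2 = 4 ^ j + 2 ^ j /\
  twisted_count s i j.*2 * 2 = 4 ^ j + 2 ^ j.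
Proof.
elim: j i => [|j IH] i s_odd //; rewrite doubleS !(square_countS, twisted_countS).
have [|sq tw] := IH i.+2; first by move=> k ik; apply: s_odd; lia.
have E2 : 2 ^ j.*2 = 4 ^ j by rewrite -mul2n expnM.
(* The bound makes the truncated subtractions exact. *)
rewrite !s_odd // !expnS E2 /=; have: 2 ^ j <= 4 ^ j by rewrite -E2 leq_exp2l //; lia.
by case: (odd i) => /=; lia.
Qed.

(** The tail alternates, as [alternating_count] requires, and [t] = 0, 1, 3 realize the values
    [n./2], [n./2.+1], [n./2.+2] of [has_negs_reduce]. *)
Definition std_sig t (i : nat) : bool := odd i || (i < t).

Lemma negs_std t n : negs (std_sig t) n = n./2 + uphalf (minn t n).
Proof.
elim: n => [|n IH]; first by rewrite minn0.
by rewrite negsS IH /std_sig; case: (ltnP n t) => ?; lia.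
Qed.

Lemma std_sig_odd t k : t <= k -> std_sig t k = odd k.
Proof. by move=> tk; rewrite /std_sig ltnNge tk orbF. Qed.

(** The counts are [2 ^ (n - 1)] minus and plus [2 ^ (n./2 - 1)], the values for the two Arf
    invariants. *)
Lemma square_count_even n : 1 < n -> ~~ odd n ->
  square_count (std_sig 1) 0 n < square_count (std_sig 0) 0 n.
Proof.
case: n => [|[|n]] // _; rewrite /= negbK => even_n.
rewrite -(odd_double_half n) (negPf even_n) add0n.
have [|sq tw] := @alternating_count (std_sig 1) 2 n./2.
  by move=> k k2; apply: std_sig_odd; lia.
have [|sq0 tw0] := @alternating_count (std_sig 0) 2 n./2.
  by move=> k k2; apply: std_sig_odd; lia.
rewrite !(square_countS, twisted_countS) /= expnS.
have E2 : 2 ^ n./2.*2 = 4 ^ n./2 by rewrite -mul2n expnM.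
have P : 0 < 2 ^ n./2 by rewrite expn_gt0.
have : 2 ^ n./2 <= 4 ^ n./2 by rewrite -E2 leq_exp2l //; lia.
by rewrite E2; lia.
Qed.

(** The middle count is [2 ^ (n - 1)], and the outer ones differ from it by [2 ^ n./2]. *)
Lemma square_count_odd n : 1 < n -> odd n ->
  square_count (std_sig 3) 0 n < square_count (std_sig 1) 0 n
    < square_count (std_sig 0) 0 n.
Proof.
case: n => [|[|[|n]]] // _; rewrite /= negbK => even_n.
rewrite -(odd_double_half n) (negPf even_n) add0n.
have E2 : 2 ^ n./2.*2 = 4 ^ n./2 by rewrite -mul2n expnM.
have P : 0 < 2 ^ n./2 by rewrite expn_gt0.
have Q : 2 ^ n./2 <= 4 ^ n./2 by rewrite -E2 leq_exp2l //; lia.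
have tail t : t <= 3 ->
    (square_count (std_sig t) 3 n./2.*2 = (4 ^ n./2 + 2 ^ n./2)./2) *
    (twisted_count (std_sig t) 3 n./2.*2 = (4 ^ n./2 + 2 ^ n./2)./2).
  move=> t3; have [|sq tw] := @alternating_count (std_sig t) 3 n./2; last by split; lia.
  by move=> k k3; apply: std_sig_odd; lia.
(* Rewritten by [tail], this says that the half in [tail] is exact. *)
have [] := @alternating_count (std_sig 0) 3 n./2.
  by move=> k k3; apply: std_sig_odd; lia.
rewrite !(square_countS, twisted_countS) /= !expnS E2 !tail //.
by move: (_./2) => X; lia.
Qed.

(** An isomorphism induces an injection [psi] on exponents; it is defined up to sign, which squaring
    removes. *)
Lemma square_count_iso n s t M N : has_generator (Some n) s M ->
  has_generator (Some n) t N -> monoid_iso M N ->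
  square_count s 0 n <= square_count t 0 n.
Proof.
move=> [e [[basic_e _ anti_e] sig_e]] [f [[_ span_f anti_f] sig_f]].
move=> [phi [phi_bij phiM phi_m]].
have phi1 : phi (sm_one M) = sm_one N.
  by have [psi _ psiK] := phi_bij; rewrite -[LHS]sm_mulx1 -(psiK (sm_one N)) -phiM sm_mul1x.
have phi_sgn b : phi (sgn M b) = sgn N b by case: b.
have exR p : exists q, size q = n /\ exists b, phi (gprod e p) = (sgn N b * gprod f q)%sm.
  by have [b [q [sz_q eq_q]]] := span_size (span_f (phi (gprod e p))); exists q; split; last exists b.
pose psi p := sval (constructive_indefinite_description _ (exR p)).
have psiP p : size (psi p) = n /\ exists b, phi (gprod e p) = (sgn N b * gprod f (psi p))%sm.
  by rewrite /psi; case: constructive_indefinite_description.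
rewrite /square_count -!size_filter -(size_map psi); apply: uniq_leq_size.
  rewrite map_inj_in_uniq ?filter_uniq ?uniq_bseqs // => p q.
  rewrite !mem_filter !mem_bseqs => /andP[_ /eqP sz_p] /andP[_ /eqP sz_q] eq_pq.
  have [_ [b eq_p]] := psiP p; have [_ [c eq_q]] := psiP q.
  have : (sgn M c * gprod e p)%sm = (sgn M b * gprod e q)%sm.
    by apply: (bij_inj phi_bij); rewrite !phiM !phi_sgn eq_p eq_q eq_pq !sgnDA addbC.
  move=> /(basic_inj anti_e sig_e basic_e)[||_]; rewrite /= ?sz_p ?sz_q //.
  by apply: xors_eq; rewrite sz_p sz_q.
move=> _ /mapP[p + ->]; rewrite !mem_filter !mem_bseqs => /andP[sq_p /eqP sz_p].
have [sz_q [b eq_p]] := psiP p; rewrite sz_q eqxx andbT.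
have := congr1 phi (gprod_sq anti_e sig_e (p := p) (eq_leq sz_p)).
rewrite phiM phi_sgn (negPf sq_p) eq_p (sgnCA b) -sm_mulA sgnDA addbb sgn0.
by rewrite (gprod_sq anti_f sig_f) /= ?sz_q // => /(@sgn_inj N _ false) ->.
Qed.

(** * Translation from signed groups to signed monoids *)

Lemma ac_generator_signature (G : signed_group) (e : nat -> G) :
  exists s, forall o, @signature (monoid_of_group G) o e s.
Proof.
exists (fun i => if excluded_middle_informative (sg_mul (e i) (e i) = sg_m G) then true else false).
move=> o i _; case: excluded_middle_informative => //= not_m.
by case: (sg_signature (e i)).
Qed.

Lemma has_ac_generator_finP n (G : signed_group) : has_ac_generator_fin n G <->
  exists s, has_generator (Some n) s (monoid_of_group G).
Proof.
split=> [[e [basic_e gen_e anti_e]]|[s [e [[basic_e gen_e anti_e] _]]]].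
  have [s sig_e] := ac_generator_signature e; exists s, e; split=> //; split=> //.
  move=> g; have [p [le_p [->|->]]] := gen_e g; [exists false, p|exists true, p] => //.
  by split=> //; rewrite sgn0.
exists e; split=> // g; have [b [p [le_p eq_g]]] := gen_e g; exists p; split=> //.
by case: b eq_g => ->; [right|left; rewrite sgn0].
Qed.

Lemma has_ac_generator_infP (G : signed_group) : has_ac_generator_inf G <->
  exists s, has_generator None s (monoid_of_group G).
Proof.
split=> [[e [basic_e gen_e anti_e]]|[s [e [[basic_e gen_e anti_e] _]]]].
  have [s sig_e] := ac_generator_signature e; exists s, e; split=> //; split=> //.
  - by move=> p _; exact: basic_e.
  - move=> g; have [p [->|->]] := gen_e g; [exists false, p|exists true, p] => //.
    by split=> //; rewrite sgn0.
  - by move=> i j _ _; exact: anti_e.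
exists e; split.
- by move=> p; exact: basic_e.
- move=> g; have [b [p [_ eq_g]]] := gen_e g; exists p.
  by case: b eq_g => ->; [right|left; rewrite sgn0].
- by move=> i j; exact: anti_e.
Qed.

(** * Representatives and classification *)

Definition std_group n t := jw_group (Some n) (std_sig t).

Lemma std_group_generator n t : has_ac_generator_fin n (std_group n t).
Proof. by apply/has_ac_generator_finP; exists (std_sig t); exact: jw_group_generator. Qed.

Lemma std_group_noniso n t u :
  square_count (std_sig u) 0 n < square_count (std_sig t) 0 n ->
  ~ sg_iso (std_group n t) (std_group n u).
Proof.
move=> lt iso; have := square_count_iso (jw_group_generator (Some n) (std_sig t))
  (jw_group_generator (Some n) (std_sig u)) iso.
by rewrite leqNgt lt.
Qed.

Lemma iso_std_group n (G : signed_group) : 1 < n -> has_ac_generator_fin n G ->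
  [\/ sg_iso G (std_group n 0), sg_iso G (std_group n 1) |
      odd n /\ sg_iso G (std_group n 3)].
Proof.
move=> n1 /has_ac_generator_finP[s gen_s].
have iso t k : n./2 + uphalf (minn t n) = k ->
    has_negs n k (monoid_of_group G) -> sg_iso G (std_group n t).
  move=> tk negs_k; apply: (@iso_of_negs n k (monoid_of_group G) (monoid_of_group (std_group n t)) negs_k).
  by exists (std_sig t); [exact: jw_group_generator|rewrite negs_std].
have [] := has_negs_reduce n1 (negs_leq s n) (ex_intro2 _ _ s gen_s erefl).
- by move/(iso 0) => iso0; constructor 1; apply: iso0; rewrite min0n addn0.
- by move/(iso 1) => iso1; constructor 2; apply: iso1; lia.
- by case=> odd_n /(iso 3) iso3; constructor 3; split=> //; apply: iso3; lia.
Qed.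

Theorem theorem4p3 :
  (* (1) n >= 2 even: exactly two isomorphism classes *)
  (forall n : nat, 2 <= n -> ~~ odd n ->
     exists G1 G2 : signed_group,
       [/\ has_ac_generator_fin n G1, has_ac_generator_fin n G2,
           ~ sg_iso G1 G2 &
           forall G : signed_group, has_ac_generator_fin n G ->
             sg_iso G G1 \/ sg_iso G G2]) /\
  (* (2) n >= 2 odd: exactly three isomorphism classes *)
  (forall n : nat, 2 <= n -> odd n ->
     exists G1 G2 G3 : signed_group,
       [/\ has_ac_generator_fin n G1, has_ac_generator_fin n G2,
           has_ac_generator_fin n G3,
           ~ sg_iso G1 G2 /\ ~ sg_iso G1 G3 /\ ~ sg_iso G2 G3 &
           forall G : signed_group, has_ac_generator_fin n G ->
             [\/ sg_iso G G1, sg_iso G G2 | sg_iso G G3]]) /\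
  (* (3) countably infinite: only one *)
  (exists G1 : signed_group,
     has_ac_generator_inf G1 /\
     forall G : signed_group, has_ac_generator_inf G -> sg_iso G G1).
Proof.
split; [|split].
- move=> n n1 even_n; exists (std_group n 0), (std_group n 1); split.
  + exact: std_group_generator.
  + exact: std_group_generator.
  + exact/std_group_noniso/square_count_even.
  + move=> G /(iso_std_group n1)[]; [by left|by right|].
    by rewrite (negPf even_n) => -[].
- move=> n n1 odd_n; have /andP[lt31 lt10] := square_count_odd n1 odd_n.
  exists (std_group n 0), (std_group n 1), (std_group n 3); split.
  + exact: std_group_generator.
  + exact: std_group_generator.
  + exact: std_group_generator.
  + split; [|split]; apply: std_group_noniso => //.
    exact: ltn_trans lt31 lt10.
  + move=> G /(iso_std_group n1)[]; [by constructor 1|by constructor 2|].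
    by case=> _; constructor 3.
- exists (jw_group None xpred0); split.
    by apply/has_ac_generator_infP; exists xpred0; exact: jw_group_generator.
  move=> G /has_ac_generator_infP[s gen_s].
  exact: (iso_of_infinite gen_s (jw_group_generator None xpred0)).
Qed.
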